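(* Let $\sigma',\tau'>0$ and suppose $$\left\lfloor -\frac{\sigma'}{\tau'}\lfloor -\sigma' x\rfloor\right\rfloor \ge \left\lfloor -\sigma'\left\lfloor -\frac{\sigma'}{\tau'}x\right\rfloor\right\rfloor \quad\text{for all } x\in\mathbb{R}.$$ (a) If at least one of $\sigma',\tau'$ is irrational, then exactly one of the following holds: (i* ) there are integers $m\ge 0$, $n\ge 1$ with $m\sigma'+n\tau'=1$; (ii* ) there are coprime positive integers $p,q$ with $p\sigma'=q\tau'\le 1$. (b) If $\sigma',\tau'$ are both rational, then there are coprime positive integers $p,q$ and integers $m\ge 0$, $n\ge 1$, $r\ge 1$ such that $$p\sigma'=q\tau'=\left(1+\frac1r\left(\frac mp+\frac nq-1\right)\right)^{-1}.$$
   Context: $\lfloor x\rfloor$ denotes the floor function. *)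

(* Defs.v *)
From mathcomp Require Export all_boot all_order all_algebra.
From mathcomp Require Export all_classical all_reals.

(* Main.v *)
Require Import Defs.
From mathcomp Require Import ring lra zify.
Import Order.TTheory GRing.Theory Num.Theory.
Local Open Scope ring_scope.

(* Substituting x = i / sigma, the hypothesis says that an integer separates
   i / tau from n / sigma whenever i / tau < n / sigma.

   If sigma / tau is irrational, pick i, n with x = n - i sigma / tau positive
   and small, and let u in [0, x / sigma) be the distance from i / tau to the
   separating integer.  Applied to the multiples of (i, n), the hypothesis keeps
   every multiple of u / x close to an integer, so u / x = l is an integer and
   i (1 - l sigma) is an integer multiple of tau.  Two values of i whose
   relations share the same l yield 1 - l sigma = n tau.

   If p sigma = q tau = s with p, q coprime, every interval [e / s, (e + 1) / s)
   with q | e and p | e + 1 contains an integer.  For irrational s, density of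
   the multiples of p q / s modulo 1 forces s <= 1; for rational s one explicit
   choice of e gives the required identity. *)

(** * Integer separation from the floor inequality *)

Definition separated_by_integers {R : realType} (sigma tau : R) : Prop :=
  forall i n : int, i%:~R * sigma < n%:~R * tau ->
    exists j : int, i%:~R <= j%:~R * tau /\ j%:~R * sigma < n%:~R.

Lemma nonneg_commutator_separated {R : realType} (sigma tau : R) :
  0 < sigma -> 0 < tau ->
  (forall x : R,
     Num.floor (- sigma * (Num.floor (- (sigma / tau) * x))%:~R)
     <= Num.floor (- (sigma / tau) * (Num.floor (- sigma * x))%:~R)) ->
  separated_by_integers sigma tau.
Proof.
move=> s0 t0 H i n lt_in.
have sN0 : sigma != 0 by rewrite gt_eqF.
have tN0 : tau != 0 by rewrite gt_eqF.
have := H (i%:~R / sigma).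
have -> : - (sigma / tau) * (i%:~R / sigma) = - (i%:~R / tau).
  by field; rewrite sN0 tN0.
have -> : - sigma * (i%:~R / sigma) = (- i)%:~R by rewrite mulrNz; field.
rewrite intrKfloor; set a := Num.floor (- (i%:~R / tau)) => Ha.
(* [- a] is the ceiling of [i / tau], the least integer that can separate. *)
exists (- a); split.
  have := floor_le (- (i%:~R / tau)).
  by rewrite -/a mulrNz -ler_pdivrMr // => Hle; lra.
have Hr : Num.floor (- (sigma / tau) * (- i)%:~R) < n.
  rewrite floor_lt_int mulrNz mulrNN mulrAC ltr_pdivrMr //.
  by rewrite [sigma * _]mulrC.
have := le_lt_trans Ha Hr.
by rewrite floor_lt_int mulrNz !mulNr [sigma * _]mulrC.
Qed.

(** * Rational numbers and Diophantine approximation *)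

Lemma rational_intr (R : realType) (z : int) : @rational R z%:~R.
Proof. by exists z%:~R => //; rewrite ratr_int. Qed.

Lemma rational_natr (R : realType) (n : nat) : @rational R n%:R.
Proof. exact: (rational_intr R n). Qed.

Lemma rational_mul {R : realType} (x y : R) :
  rational x -> rational y -> rational (x * y).
Proof. by case=> a _ <- [b _ <-]; exists (a * b) => //; rewrite rmorphM. Qed.

Lemma rational_div {R : realType} (x y : R) :
  rational x -> rational y -> rational (x / y).
Proof. by case=> a _ <- [b _ <-]; exists (a / b) => //; rewrite fmorph_div. Qed.

Lemma irrational_linear_eq0 {R : realType} (x y : R) (a b : int) :
  y != 0 -> irrational (x / y) -> a%:~R * x = b%:~R * y -> a = 0.
Proof.
move=> yN0 irr E; apply/eqP/negP => /negP aN0; apply: irr.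
have aR : a%:~R != 0 :> R by rewrite intr_eq0.
have -> : x / y = b%:~R / a%:~R.
  by apply/eqP; rewrite eqr_div // mulrC E.
exact: rational_div (rational_intr _ _) (rational_intr _ _).
Qed.

Lemma pos_rational_coprime {R : realType} (x : R) : rational x -> 0 < x ->
  exists p q : nat, [/\ (0 < p)%N, (0 < q)%N, coprime p q & x = p%:R / q%:R].
Proof.
case=> r _ <-; rewrite ltr0q => r0.
have n0 : 0 < numq r by rewrite numq_gt0.
exists `|numq r|%N, `|denq r|%N; split.
- by rewrite absz_gt0 gt_eqF.
- by rewrite absz_gt0 gt_eqF // denq_gt0.
- exact: coprime_num_den.
by rewrite /ratr !natr_absz !gtr0_norm ?denq_gt0.
Qed.

Lemma exists_multiple_in_Ioc {R : realType} (c y : R) : 0 < y ->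
  exists k : int, c < k%:~R * y /\ k%:~R * y <= c + y.
Proof.
move=> y0; exists (Num.floor (c / y) + 1).
have /andP[h1 h2] := floor_itv (c / y).
rewrite -ltr_pdivrMr //; split=> //.
by rewrite intrD mulrDl mul1r lerD2r -ler_pdivlMr.
Qed.

(** Induction by Euclidean division: dividing 1 by [y] leaves a nonzero remainder [r < y], and the
    smaller of [r] and [y - r] is at most [y / 2]. *)
Lemma irrational_small_combination {R : realType} (phi : R) (N : nat) :
  irrational phi -> exists t n : int,
    0 < n%:~R + t%:~R * phi /\ (n%:~R + t%:~R * phi) * 2 ^+ N < 1.
Proof.
move=> irr; elim: N => [|N [t [n [y0 y1]]]].
  exists 1, (- Num.floor phi); rewrite expr0 mulr1.
  have /andP[h1 h2] := floor_itv phi.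
  have hN : (Num.floor phi)%:~R != phi.
    by apply/eqP => E; apply: irr; rewrite -E; exact: rational_intr.
  by rewrite mulrNz; move: h2; rewrite intrD => h2; split; lra.
set y := n%:~R + t%:~R * phi in y0 y1.
have y_lt1 : y < 1.
  have P1 : 1 <= 2 ^+ N :> R by rewrite exprn_ege1 // ler1n.
  by apply: le_lt_trans y1; rewrite ler_peMr // ltW.
have [k [k1 k2]] := exists_multiple_in_Ioc (1 - y) y y0.
rewrite subrK in k2.
pose r := 1 - k%:~R * y.
(* If [r = 0], irrationality forces [k t = 0]; then either [r = 1], or [y] is an integer strictly
   between 0 and 1. *)
have rN0 : r != 0.
  apply/eqP => r0.
  have E : (k * t)%:~R * phi = (1 - k * n)%:~R * 1.
    by move: r0; rewrite /r /y intrM intrB intrM => r0; lra.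
  have kt0 : k * t = 0.
    by apply: irrational_linear_eq0 E; rewrite ?oner_eq0 // divr1.
  move/eqP: kt0; rewrite mulf_eq0 => /orP[]/eqP z.
    by move: r0; rewrite /r z mul0r => r0; lra.
  move: y0 y_lt1; rewrite /y z mul0r addr0 ltr0z ltrz1; lia.
have r0 : 0 < r by rewrite lt_neqAle eq_sym rN0 /r; lra.
have ry : r < y by rewrite /r; lra.
rewrite exprS.
have P0 : 0 < 2 ^+ N :> R by rewrite exprn_gt0.
case: (lerP (r * 2) y) => h.
  exists (- k * t), (1 - k * n).
  have -> : (1 - k * n)%:~R + (- k * t)%:~R * phi = r.
    by rewrite /r /y intrB !intrM mulrNz; ring.
  by split=> //; nra.
exists (t + k * t), (n + k * n - 1).
have -> : (n + k * n - 1)%:~R + (t + k * t)%:~R * phi = y - r.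
  by rewrite /r /y intrB !intrD !intrM; ring.
by split; [lra | nra].
Qed.

(** The multiples of a positive combination [y < delta] advance in steps shorter than [delta], so
    the first one above [- c] exceeds it by less than [delta]. *)
Lemma irrational_rotation_dense {R : realType} (phi c delta : R) :
  irrational phi -> 0 < delta ->
  exists t n : int, 0 < n%:~R + t%:~R * phi + c < delta.
Proof.
move=> irr d0.
pose N := Num.truncn delta^-1.
have [t [n [y0 y1]]] := irrational_small_combination phi N irr.
set y := n%:~R + t%:~R * phi in y0 y1.
have yd : y < delta.
  have hN : delta^-1 < (2 ^ N)%:R.
    have /andP[_ h] := truncn_itv (ltW (etrans (invr_gt0 delta) d0)).
    by apply: lt_le_trans h _; rewrite ler_nat ltn_expl.
  rewrite natrX in hN.
  have : 1 < 2 ^+ N * delta by rewrite -ltr_pdivrMr // div1r.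
  move=> h; have P0 : 0 < 2 ^+ N :> R by rewrite exprn_gt0.
  by rewrite -(ltr_pM2r P0); apply: lt_trans y1 _; rewrite mulrC.
have [k [k1 k2]] := exists_multiple_in_Ioc (- c) y y0.
exists (k * t), (k * n).
have -> : (k * n)%:~R + (k * t)%:~R * phi + c = k%:~R * y + c.
  by rewrite !intrM /y; ring.
by apply/andP; split; lra.
Qed.

(** * Irrational ratio [sigma / tau] *)

(** The case [c = 1] puts [x] within 1/4 of some integer [l]. If [x] differs from [l], the first
    multiple of the distance above 1/4 stays below 1/2, too far from every integer. *)
Lemma near_integer_multiples_int {R : realType} (x : R) :
  (forall c : int, exists d : int,
     - 4^-1 < c%:~R * x - d%:~R /\ c%:~R * x - d%:~R < 4^-1) ->
  exists l : int, x = l%:~R.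
Proof.
move=> H; have [l []] := H 1; rewrite mul1r => h1 h2.
exists l; apply/eqP; rewrite -subr_eq0; apply/negP => /negP dN0.
have [c [c1 c2]] := exists_multiple_in_Ioc 4^-1 `|x - l%:~R|
                      (etrans (normr_gt0 _) dN0).
have dl : `|x - l%:~R| < 4^-1 by rewrite ltr_norml; lra.
have [d [d1 d2]] := H c.
have : exists e : int, `|c%:~R * `|x - l%:~R| - e%:~R| < 4^-1.
  have [x0|x0] := lerP 0 (x - l%:~R).
    by exists (d - c * l); rewrite (ger0_norm x0) ltr_norml intrB intrM; lra.
  by exists (c * l - d); rewrite (ltr0_norm x0) ltr_norml intrB intrM; lra.
case=> e; rewrite ltr_norml => /andP[e1 e2].
have : 0 < e%:~R :> R by lra.
have : e%:~R < 1 :> R by lra.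
by rewrite ltr0z ltrz1; lia.
Qed.

(* For c < k x <= c + x the integer separating k i from k n - c shows that
   c lambda lies within 1/4 of an integer; hence lambda itself is an integer. *)
Lemma separated_integral_slope {R : realType} (sigma tau : R) (i n : int) :
  0 < sigma -> 0 < tau -> separated_by_integers sigma tau ->
  0 < n%:~R - i%:~R * (sigma / tau) < sigma / 4 ->
  exists l m : int,
    [/\ 0 <= l, l%:~R * sigma < 1 & i%:~R * (1 - l%:~R * sigma) = m%:~R * tau].
Proof.
move=> s0 t0 H; set x := n%:~R - _ => /andP[x0 xs].
have tN0 : tau != 0 by rewrite gt_eqF.
have sN0 : sigma != 0 by rewrite gt_eqF.
have xE : x * tau = n%:~R * tau - i%:~R * sigma by rewrite /x; field.
have [j [j1 j2]] : exists j : int,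
    i%:~R <= j%:~R * tau /\ j%:~R * sigma < n%:~R.
  by apply: H; rewrite -subr_gt0 -xE mulr_gt0.
pose u := j%:~R - i%:~R / tau.
have uE : u * tau = j%:~R * tau - i%:~R by rewrite /u; field.
have u0 : 0 <= u by rewrite /u subr_ge0 ler_pdivrMr.
have usx : u * sigma < x.
  have -> : u * sigma = j%:~R * sigma - i%:~R * (sigma / tau).
    by rewrite /u; field.
  by rewrite /x ltrD2r.
have xN0 : x != 0 by rewrite gt_eqF.
pose lam := u / x.
have lamE : lam * x = u by rewrite /lam divfK.
have [l lE] : exists l : int, lam = l%:~R.
  apply: near_integer_multiples_int => c.
  have [k [k1 k2]] := exists_multiple_in_Ioc c%:~R x x0.
  have [j' [j'1 j'2]] : exists j' : int,
      (k * i)%:~R <= j'%:~R * tau /\ j'%:~R * sigma < (k * n - c)%:~R.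
    apply: H; rewrite -subr_gt0.
    have -> : (k * n - c)%:~R * tau - (k * i)%:~R * sigma
              = (k%:~R * x - c%:~R) * tau.
      by rewrite mulrBl -mulrA xE intrB !intrM; ring.
    by rewrite mulr_gt0 // subr_gt0.
  (* The difference [k u - (k j - j')] is the gap from [k i / tau] to [j'], which is below
     [(k x - c) / sigma <= x / sigma < 1/4]. *)
  exists (k * j - j').
  have e1 : 0 <= k%:~R * u - (k * j - j')%:~R.
    have -> : k%:~R * u - (k * j - j')%:~R = j'%:~R - (k * i)%:~R / tau.
      by rewrite /u intrB !intrM; ring.
    by rewrite subr_ge0 ler_pdivrMr.
  have e2 : (k%:~R * u - (k * j - j')%:~R) * sigma < k%:~R * x - c%:~R.
    have -> : (k%:~R * u - (k * j - j')%:~R) * sigma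
              = j'%:~R * sigma - (k * i)%:~R * (sigma / tau).
      by rewrite /u intrB !intrM; ring.
    have -> : k%:~R * x - c%:~R = (k * n - c)%:~R - (k * i)%:~R * (sigma / tau).
      by rewrite /x intrB !intrM; ring.
    by rewrite ltrD2r.
  set d := (k * j - j')%:~R in e1 e2 *.
  have lam0 : 0 <= lam by rewrite /lam divr_ge0 // ltW.
  have u4 : u < 4^-1 by rewrite -(ltr_pM2r s0); lra.
  have e3 : k%:~R * u - d < 4^-1 by rewrite -(ltr_pM2r s0); lra.
  have e4 : lam * c%:~R <= lam * (k%:~R * x) by rewrite ler_wpM2l // ltW.
  have e5 : lam * (k%:~R * x) <= lam * (c%:~R + x) by rewrite ler_wpM2l.
  have e6 : lam * (k%:~R * x) = k%:~R * u by rewrite mulrCA lamE.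
  have e7 : lam * (c%:~R + x) = lam * c%:~R + u by rewrite mulrDr lamE.
  rewrite e6 in e4; rewrite e6 e7 in e5.
  by rewrite [_ * lam]mulrC; split; lra.
rewrite lE in lamE.
(* Multiplying [l x = u] by [tau] gives [l (n tau - i sigma) = j tau - i], whence [m = j - l n]. *)
exists l, (j - l * n); split.
- by rewrite -(ler0z R) -lE divr_ge0 // ltW.
- by rewrite -(ltr_pM2r x0) mul1r mulrAC lamE.
have : l%:~R * (x * tau) = u * tau by rewrite mulrA lamE.
by rewrite xE uE intrB intrM => E; lra.
Qed.

Lemma separated_irrational_ratio {R : realType} (sigma tau : R) :
  0 < sigma -> 0 < tau -> separated_by_integers sigma tau ->
  irrational (sigma / tau) ->
  exists m n : nat, (1 <= n)%N /\ m%:R * sigma + n%:R * tau = 1.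
Proof.
move=> s0 t0 H irr.
have tN0 : tau != 0 by rewrite gt_eqF.
have step (D : int) : D != 0 -> exists t l m : int,
    [/\ 0 <= l, l%:~R * sigma < 1 &
      (1 + D * t)%:~R * (1 - l%:~R * sigma) = m%:~R * tau].
  move=> DN0.
  have irrD : irrational (- (D%:~R * (sigma / tau))).
    move=> rat; apply: irr.
    have DR : - D%:~R != 0 :> R by rewrite oppr_eq0 intr_eq0.
    have -> : sigma / tau = - (D%:~R * (sigma / tau)) / (- D)%:~R.
      by rewrite mulrNz -mulNr mulrAC mulfV ?mul1r.
    exact: rational_div rat (rational_intr _ _).
  have d0 : 0 < sigma / 4 by lra.
  have [t [n tn]] :=
    irrational_rotation_dense _ (- (sigma / tau)) _ irrD d0.
  exists t; apply: (separated_integral_slope _ _ _ n) => //.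
  suff -> : n%:~R - (1 + D * t)%:~R * (sigma / tau)
            = n%:~R + t%:~R * - (D%:~R * (sigma / tau)) + - (sigma / tau) by [].
  by rewrite intrD intrM; ring.
(* Modulus 2 keeps [i1] odd, hence nonzero; modulus [2 i1] makes [i2] odd as well, and congruent to
   1 modulo [i1]. *)
have [t1 [l1 [m1 [l1_ge0 l1s E1]]]] := step 2 isT.
set i1 := 1 + 2 * t1 in E1.
have i1N0 : i1 != 0 by rewrite /i1; lia.
have [t2 [l2 [m2 [_ _ E2]]]] := step (2 * i1) ltac:(by rewrite mulf_neq0).
set i2 := 1 + 2 * i1 * t2 in E2.
have i2N0 : i2 != 0 by rewrite /i2; lia.
have E : (i1 * i2 * (l2 - l1))%:~R * sigma = (i2 * m1 - i1 * m2)%:~R * tau.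
  have e1 := congr1 (fun z => i2%:~R * z) E1.
  have e2 := congr1 (fun z => i1%:~R * z) E2.
  rewrite /= in e1 e2.
  by rewrite !(intrM, intrB); lra.
have L := irrational_linear_eq0 _ _ _ _ tN0 irr E.
have M : i2 * m1 = i1 * m2.
  move: E; rewrite L mul0r => /esym/eqP.
  by rewrite mulf_eq0 (negPf tN0) orbF intr_eq0 subr_eq0 => /eqP.
(* Since [i2 = 1 + 2 i1 t2], the equality [M] exhibits [m1] as a multiple of [i1], so [i1] can be
   cancelled from [E1]. *)
pose n := m2 - 2 * t2 * m1.
have m1E : m1 = i1 * n by rewrite /n mulrBr -M /i2; ring.
have E3 : 1 - l1%:~R * sigma = n%:~R * tau.
  have i1R : i1%:~R != 0 :> R by rewrite intr_eq0.
  by apply: (mulfI i1R); rewrite E1 m1E intrM mulrA.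
have n0 : 0 < n.
  by rewrite -(ltr0z R) -(pmulr_lgt0 _ t0) -E3 subr_gt0.
exists `|l1|%N, `|n|%N; split; first by rewrite absz_gt0 gt_eqF.
rewrite !natr_absz ger0_norm // gtr0_norm // -E3; ring.
Qed.

(** * Commensurable [sigma] and [tau] *)

(** With [s = p sigma = q tau], multiplying the premise of separation by [p q] turns it into
    [0 < (p n - q i) s], true because [p n - q i = 1]. *)
Lemma separated_commensurable {R : realType} (sigma tau : R) (p q : nat)
    (i n : int) :
  0 < tau -> (0 < p)%N -> (0 < q)%N -> p%:R * sigma = q%:R * tau ->
  separated_by_integers sigma tau -> q%:Z * i + 1 = p%:Z * n ->
  exists j : int, (q%:Z * i)%:~R <= j%:~R * (q%:R * tau)
               /\ j%:~R * (q%:R * tau) < (q%:Z * i + 1)%:~R.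
Proof.
move=> t0 p0 q0 E H En.
have pR : 0 < p%:R :> R by rewrite ltr0n.
have qR : 0 < q%:R :> R by rewrite ltr0n.
have [|j [j1 j2]] := H i n.
  rewrite -(ltr_pM2l (mulr_gt0 pR qR)) -subr_gt0.
  have -> : p%:R * q%:R * (n%:~R * tau) - p%:R * q%:R * (i%:~R * sigma)
      = (p%:Z * n - q%:Z * i)%:~R * (q%:R * tau).
    have -> : p%:R * q%:R * (i%:~R * sigma) = q%:R * i%:~R * (p%:R * sigma).
      by ring.
    by rewrite E intrB !intrM -!pmulrn; ring.
  by rewrite -En addrAC subrr add0r mul1r mulr_gt0.
exists j; rewrite En !intrM -!pmulrn; split.
  by rewrite mulrCA ler_pM2l.
by rewrite -E mulrCA ltr_pM2l.
Qed.

Lemma coprime_consecutive_multiples (p q : nat) : coprime p q ->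
  exists i n : int, q%:Z * i + 1 = p%:Z * n.
Proof.
move=> /eqP cpq; have [u [v uv]] := Bezoutz p%:Z q%:Z.
exists (- v), u.
have : u * p%:Z + v * q%:Z = 1 by rewrite uv /gcdz /= cpq.
by lia.
Qed.

Lemma separated_commensurable_irrational {R : realType} (sigma tau : R)
    (p q : nat) :
  0 < tau -> (0 < p)%N -> (0 < q)%N -> coprime p q ->
  p%:R * sigma = q%:R * tau -> separated_by_integers sigma tau ->
  irrational (q%:R * tau) -> q%:R * tau <= 1.
Proof.
move=> t0 p0 q0 cpq E H irr; set s := q%:R * tau in irr *.
rewrite leNgt; apply/negP => s1.
have s0 : 0 < s by apply: lt_trans s1.
have sN0 : s != 0 by rewrite gt_eqF.
have [i0 [n0 E0]] := coprime_consecutive_multiples p q cpq.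
have irr' : irrational ((p * q)%:R / s).
  move=> rat; apply: irr.
  have pqN0 : (p * q)%:R != 0 :> R by rewrite pnatr_eq0 -lt0n muln_gt0 p0.
  have -> : s = (p * q)%:R / ((p * q)%:R / s) by rewrite invf_div mulrC divfK.
  exact: rational_div (rational_natr _ _) rat.
(* The interval [[e / s, (e + 1) / s)] has length [1 / s]; if [e / s] exceeds the integer [- n] by a
   positive amount below [1 - 1 / s], the interval contains no integer. *)
have d0 : 0 < 1 - s^-1 by rewrite subr_gt0 invf_lt1.
have [t [n /andP[h1 h2]]] :=
  irrational_rotation_dense _ ((q%:Z * i0)%:~R / s) _ irr' d0.
have [j [j1 j2]] : exists j : int, (q%:Z * (i0 + p%:Z * t))%:~R <= j%:~R * s
               /\ j%:~R * s < (q%:Z * (i0 + p%:Z * t) + 1)%:~R.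
  apply: (separated_commensurable _ _ p q _ (n0 + q%:Z * t)) E H _ => //.
  by rewrite !mulrDr -E0; ring.
set e := (q%:Z * (i0 + p%:Z * t)) in j1 j2.
have eE : n%:~R + t%:~R * ((p * q)%:R / s) + (q%:Z * i0)%:~R / s
          = (n%:~R * s + e%:~R) / s.
  by rewrite /e !(intrM, intrD) -!pmulrn natrM; field.
rewrite {}eE in h1 h2.
move: h1; rewrite pmulr_lgt0 ?invr_gt0 // => h1.
have {}h2 : n%:~R * s + e%:~R < s - 1.
  by move: h2; rewrite ltr_pdivrMr // mulrBl mulVf // mul1r.
rewrite intrD in j2.
have k1 : 0 < (j + n)%:~R :> R by rewrite -(pmulr_lgt0 _ s0) intrD; lra.
have k2 : (j + n)%:~R < 1 :> R by rewrite -(ltr_pM2r s0) intrD; lra.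
by move: k1 k2; rewrite ltr0z ltrz1; lia.
Qed.

(* With g = gcd(pq, N) choose i so that q i D is congruent modulo N to some k in
   [1, g].  The integer j then forces N - D < k, and the witnesses are
   r = N / g, m = p (g - k) / g and n = q (k - (N - D)) / g. *)
Lemma commensurable_rational_witnesses (p q N D : nat) :
  (0 < p)%N -> (0 < q)%N -> (0 < N)%N -> coprime p q -> coprime N D ->
  (forall i n : int, q%:Z * i + 1 = p%:Z * n ->
     exists j : int, q%:Z * i * D%:Z <= j * N%:Z
                  /\ j * N%:Z < (q%:Z * i + 1) * D%:Z) ->
  exists m n r : int, [/\ 0 <= m, 0 < n, 0 < r &
    r * (N%:Z - D%:Z) * p%:Z * q%:Z + m * N%:Z * q%:Z + n * N%:Z * p%:Z
    = N%:Z * p%:Z * q%:Z].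
Proof.
move=> p0 q0 N0 cpq cND H.
have [i0 [n0 E0]] := coprime_consecutive_multiples p q cpq.
have [b [a E1]] := coprime_consecutive_multiples _ _ cND.
have [u [v E2]] := Bezoutz (p%:Z * q%:Z) N%:Z.
set g := gcdz _ _ in E2.
have g0 : 0 < g.
  rewrite lt0r gcdz_eq0 negb_and; apply/andP; split=> //.
  by apply/orP; right; lia.
have /dvdzP[G GE] : (g %| p%:Z * q%:Z)%Z by exact: dvdz_gcdl.
have /dvdzP[r rE] : (g %| N%:Z)%Z by exact: dvdz_gcdr.
(* The offset by 1 makes [k] the residue of [q i0 D] modulo [g] in [[1, g]] instead of
   [[0, g - 1]]. *)
pose w := - ((q%:Z * i0 * D%:Z - 1) %/ g)%Z.
pose k := q%:Z * i0 * D%:Z + g * w.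
have gN0 : g != 0 by rewrite gt_eqF.
have kE : k = ((q%:Z * i0 * D%:Z - 1) %% g)%Z + 1.
  have := divz_eq (q%:Z * i0 * D%:Z - 1) g; rewrite /k /w => e.
  by rewrite mulrN mulrC; move: e; lia.
have k_ge1 : 1 <= k by rewrite kE lerDr modz_ge0.
have k_leg : k <= g.
  by have := ltz_pmod (q%:Z * i0 * D%:Z - 1) g0; rewrite kE; lia.
(* Modulo [N], [D b] is [- 1] and [u p q] is [g], so adding [p t] to [i0] shifts [q i D] by
   [g w]. *)
pose t := - u * b * w; pose i := i0 + p%:Z * t; pose n := n0 + q%:Z * t.
have En : q%:Z * i + 1 = p%:Z * n by rewrite /i /n !mulrDr -E0; ring.
pose f := w * (v + u * p%:Z * q%:Z * a).
have iE : q%:Z * i * D%:Z = k - N%:Z * f.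
  have -> : q%:Z * i * D%:Z
      = q%:Z * i0 * D%:Z - w * (u * (p%:Z * q%:Z)) * (D%:Z * b).
    by rewrite /i /t; ring.
  have -> : D%:Z * b = N%:Z * a - 1 by lia.
  by rewrite /k /f -E2; ring.
have [j [j1 j2]] := H i n En.
have NZ : 0 < N%:Z by lia.
(* The lower bound on [j] gives [(j + f) N >= k > 0], so [j + f >= 1]; the upper one gives
   [N <= (j + f) N < k + D]. *)
have hk : N%:Z - D%:Z < k.
  rewrite mulrDl mul1r in j2; rewrite iE in j1 j2.
  have : 0 < (j + f) * N%:Z by lia.
  rewrite pmulr_lgt0 // => jf; have : 1 <= j + f by lia.
  by rewrite -(ler_pM2r NZ); lia.
have G0 : 0 < G by rewrite -(pmulr_lgt0 _ g0) -GE; lia.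
have r0 : 0 < r by rewrite -(pmulr_lgt0 _ g0) -rE.
(* Division-free forms of [p (g - k) / g] and [q (k - (N - D)) / g], visibly integers; [mE] and [nE]
   confirm them through [p q = G g]. *)
pose m := p%:Z - G * i * D%:Z - p%:Z * r * f.
pose n' := G * n * D%:Z + q%:Z * r * (f - 1).
have GN : G * N%:Z = p%:Z * q%:Z * r by rewrite rE GE; ring.
have mE : m * q%:Z = G * (g - k).
  have -> : k = q%:Z * i * D%:Z + N%:Z * f by rewrite iE; ring.
  have -> : G * (g - (q%:Z * i * D%:Z + N%:Z * f))
    = G * g - G * q%:Z * i * D%:Z - G * N%:Z * f by ring.
  by rewrite -GE GN /m; ring.
have nE : n' * p%:Z = G * (k - (N%:Z - D%:Z)).
  have -> : k = q%:Z * i * D%:Z + N%:Z * f by rewrite iE; ring.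
  have -> : G * (q%:Z * i * D%:Z + N%:Z * f - (N%:Z - D%:Z))
    = G * (q%:Z * i + 1) * D%:Z + G * N%:Z * (f - 1) by ring.
  by rewrite En GN /n'; ring.
exists m, n', r; split=> //.
- have qZ : 0 < q%:Z by lia.
  by rewrite -(pmulr_lge0 _ qZ) mE pmulr_rge0 // subr_ge0.
- have pZ : 0 < p%:Z by lia.
  by rewrite -(pmulr_lgt0 _ pZ) nE mulr_gt0 // subr_gt0.
have -> : r * (N%:Z - D%:Z) * p%:Z * q%:Z + m * N%:Z * q%:Z + n' * N%:Z * p%:Z
  = p%:Z * q%:Z * r * (N%:Z - D%:Z) + N%:Z * (m * q%:Z + n' * p%:Z) by ring.
by rewrite mE nE -GN -[RHS]mulrA GE; ring.
Qed.

(** * Assembly of the irrational and rational cases *)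

Theorem theorem6p1 (R : realType) (sigma tau : R)
    (sigma_gt0 : 0 < sigma) (tau_gt0 : 0 < tau)
    (Hfloor : forall x : R,
       Num.floor (- sigma * (Num.floor (- (sigma / tau) * x))%:~R)
       <= Num.floor (- (sigma / tau) * (Num.floor (- sigma * x))%:~R)) :
  ((irrational sigma \/ irrational tau) ->
     let istar := exists m n : nat,
       (1 <= n)%N /\ m%:R * sigma + n%:R * tau = 1 in
     let iistar := exists p q : nat,
       [/\ (0 < p)%N, (0 < q)%N, coprime p q,
           p%:R * sigma = q%:R * tau & q%:R * tau <= 1] in
     (istar \/ iistar) /\ ~ (istar /\ iistar))
  /\
  ((rational sigma /\ rational tau) ->
     exists p q m n r : nat,
       [/\ [/\ (0 < p)%N, (0 < q)%N & coprime p q],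
           (1 <= n)%N, (1 <= r)%N,
           p%:R * sigma = q%:R * tau
         & q%:R * tau =
           (1 + r%:R^-1 * (m%:R / p%:R + n%:R / q%:R - 1))^-1]).
Proof.
have H := nonneg_commutator_separated _ _ sigma_gt0 tau_gt0 Hfloor.
have tN0 : tau != 0 by rewrite gt_eqF.
have ratio : rational (sigma / tau) -> exists p q : nat,
    [/\ (0 < p)%N, (0 < q)%N, coprime p q & p%:R * sigma = q%:R * tau].
  move=> rat; have st0 : 0 < sigma / tau by rewrite divr_gt0.
  have [q [p [q0 p0 cqp E]]] := pos_rational_coprime _ rat st0.
  exists p, q; split=> //; first by rewrite coprime_sym.
  have pN0 : p%:R != 0 :> R by rewrite pnatr_eq0 -lt0n.
  by move/eqP: E; rewrite eqr_div // mulrC => /eqP.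
split.
  move=> irr /=; have rat_contra p q : (0 < p)%N -> (0 < q)%N ->
      p%:R * sigma = q%:R * tau -> ~ rational (q%:R * tau).
    move=> p0 q0 E rat.
    have pN0 : p%:R != 0 :> R by rewrite pnatr_eq0 -lt0n.
    have qN0 : q%:R != 0 :> R by rewrite pnatr_eq0 -lt0n.
    case: irr; apply.
      rewrite -[sigma](mulKf pN0) E mulrC.
      exact: rational_div rat (rational_natr _ _).
    rewrite -[tau](mulKf qN0) mulrC.
    exact: rational_div rat (rational_natr _ _).
  split.
    have [rat|nrat] := pselect (rational (sigma / tau)); last first.
      by left; exact: separated_irrational_ratio H nrat.
    right; have [p [q [p0 q0 cpq E]]] := ratio rat.
    exists p, q; split=> //.
    apply: (separated_commensurable_irrational sigma tau p q) => //.
    exact: rat_contra p0 q0 E.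
  case=> -[m [n [n1 E1]]] [p [q [p0 q0 cpq E _]]].
  apply: (rat_contra _ _ p0 q0 E).
  have pR : 0 < p%:R :> R by rewrite ltr0n.
  have qR : 0 < q%:R :> R by rewrite ltr0n.
  have c0 : 0 < (m * q + n * p)%:R :> R.
    by rewrite ltr0n addn_gt0 !muln_gt0 n1 p0 orbT.
  (* Multiplying [m sigma + n tau = 1] by [p q] gives [(m q + n p) q tau = p q], so both
     alternatives together make [q tau] rational. *)
  have -> : q%:R * tau = (p * q)%:R / (m * q + n * p)%:R.
    apply: (canRL (mulfK (lt0r_neq0 c0))); rewrite natrD !natrM.
    rewrite -[RHS]mulr1 -[X in _ = _ * X]E1.
    have -> : p%:R * q%:R * (m%:R * sigma + n%:R * tau)
      = m%:R * q%:R * (p%:R * sigma) + n%:R * p%:R * (q%:R * tau) by ring.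
    by rewrite E; ring.
  exact: rational_div (rational_natr _ _) (rational_natr _ _).
move=> [rs rt]; have [p [q [p0 q0 cpq E]]] := ratio (rational_div _ _ rs rt).
have pR : 0 < p%:R :> R by rewrite ltr0n.
have qR : 0 < q%:R :> R by rewrite ltr0n.
have [N [D [N0 D0 cND sE]]] := pos_rational_coprime _
  (rational_mul _ _ (rational_natr R q) rt) (mulr_gt0 qR tau_gt0).
have NR : 0 < N%:R :> R by rewrite ltr0n.
have DR : 0 < D%:R :> R by rewrite ltr0n.
have [m [n [r [m0 n0 r0 eq]]]] : exists m n r : int, [/\ 0 <= m, 0 < n, 0 < r &
    r * (N%:Z - D%:Z) * p%:Z * q%:Z + m * N%:Z * q%:Z + n * N%:Z * p%:Z
    = N%:Z * p%:Z * q%:Z].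
  apply: commensurable_rational_witnesses => // i n En.
  have [j [j1 j2]] := separated_commensurable _ _ _ _ _ _ tau_gt0 p0 q0 E H En.
  exists j; move: j1 j2; rewrite sE mulrA ler_pdivlMr // ltr_pdivrMr //.
  by rewrite !pmulrn -!intrM ler_int ltr_int.
exists p, q, `|m|%N, `|n|%N, `|r|%N; split; rewrite ?absz_gt0 ?gt_eqF //.
rewrite sE -[LHS]invrK invf_div; congr (_^-1).
have rR : 0 < r%:~R :> R by rewrite ltr0z.
rewrite !natr_absz (ger0_norm m0) (gtr0_norm n0) (gtr0_norm r0).
have {}eq := congr1 (fun z : int => z%:~R : R) eq.
rewrite /= !(intrB, intrD, intrM) -!pmulrn in eq.
apply/eqP; rewrite -subr_eq0; apply/eqP.
(* The integer identity divided by [r N p q] is the required formula for [D / N], the inverse of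
   [q tau]. *)
have -> : D%:R / N%:R - (1 + r%:~R^-1 * (m%:~R / p%:R + n%:~R / q%:R - 1))
  = (N%:R * p%:R * q%:R - (r%:~R * (N%:R - D%:R) * p%:R * q%:R
      + m%:~R * N%:R * q%:R + n%:~R * N%:R * p%:R))
    / (r%:~R * N%:R * p%:R * q%:R) :> R.
  by field; rewrite !gt_eqF.
by rewrite eq subrr mul0r.
Qed.
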